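(* Let $X\subseteq S^1$ and $0<r<\frac12$. Define $$T_r(X)=\tfrac{1}{1+2r}X\ \cup\ \Big(\tfrac{1}{1+2r}\big(X\cap[0,2r)_{S^1}\big)+\tfrac{1}{1+2r}\Big),$$ and let $\pi_r:S^1\to S^1$ be the (non-continuous) map $\pi_r(y)=(1+2r)y\bmod 1$ for $y\in[0,1)$. Then $\pi_r$ maps $T_r(X)$ onto $X$ and induces a simplicial map $$\pi_r:\mathbf{VR}_{\le}\Big(T_r(X);\tfrac{2r}{1+2r}\Big)\to\check{\mathbf C}_{\le}(X;r)$$ which is a homotopy equivalence.
   Context: $S^1$ is the circle of circumference $1$ with the arc-length metric; each point is identified with a number in $[0,1)$, and for $X\subseteq S^1$ and $a,b\in\mathbb R$, $aX+b=\{(ax+b)\bmod 1: x\in X\}$ with $x$ represented in $[0,1)$. $[0,2r)_{S^1}$ is the half-open clockwise arc from $0$ to $2r$. $\mathbf{VR}_{\le}(Y;s)$ is the Vietoris–Rips complex: vertex set $Y$, faces the finite subsets of diameter at most $s$. $\check{\mathbf C}_{\le}(X;r)$ is the Čech complex: vertex set $X$, and a finite $\sigma\subseteq X$ is a face iff the closed balls of radius $r$ in $S^1$ about the points of $\sigma$ have a common point (equivalently $\sigma$ lies in a closed arc of length $2r$). Complexes carry the CW (weak) topology. *)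

(* Defs.v *)
From HB Require Import structures.
From mathcomp Require Import all_boot all_order all_algebra.
From mathcomp Require Import boolp classical_sets functions cardinality fsbigop reals.
Set Implicit Arguments. Unset Strict Implicit. Unset Printing Implicit Defensive.
Import Order.TTheory GRing.Theory Num.Theory.
Local Open Scope classical_set_scope.
Local Open Scope ring_scope.

Section Defs.
Variable R : realType.

(** * The circle S^1 of circumference 1, points identified with [0,1). *)
Definition on_circle (x : R) : Prop := 0 <= x /\ x < 1.

Definition mod1 (x : R) : R := x - (Num.floor x)%:~R.

(** arc-length (geodesic) distance on S^1, for x, y in [0,1) *)
Definition circ_dist (x y : R) : R := Num.min `|x - y| (1 - `|x - y|).

Definition scale_shift (a b : R) (X : set R) : set R :=
  [set mod1 (a * x + b) | x in X].

Definition arc0 (l : R) : set R := [set x | 0 <= x /\ x < l].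

Definition T_r (r : R) (X : set R) : set R :=
  scale_shift (1 + 2 * r)^-1 0 X `|`
  scale_shift (1 + 2 * r)^-1 (1 + 2 * r)^-1 (X `&` arc0 (2 * r)).

Definition pi_r (r : R) (y : R) : R := mod1 ((1 + 2 * r) * y).

(** * Abstract simplicial complexes with vertices in R:
    a complex is given by its set of faces (finite nonempty sets of vertices). *)
Definition complex := set (set R).

Definition VR (Y : set R) (s : R) : complex :=
  [set sigma | [/\ finite_set sigma, sigma !=set0, sigma `<=` Y &
     forall x y, sigma x -> sigma y -> circ_dist x y <= s]].

Definition Cech (X : set R) (r : R) : complex :=
  [set sigma | [/\ finite_set sigma, sigma !=set0, sigma `<=` X &
     exists p, on_circle p /\ forall x, sigma x -> circ_dist x p <= r]].

Definition simplicial (K L : complex) (phi : R -> R) : Prop :=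
  forall sigma, K sigma -> L (phi @` sigma).

(** * Geometric realization |K|: finitely supported barycentric coordinates
    f : R -> R whose support is a face, f >= 0, sum f = 1. *)
Definition supp (f : R -> R) : set R := [set v | f v != 0].

Definition realization (K : complex) : set (R -> R) :=
  [set f | [/\ K (supp f), (forall v, 0 <= f v) &
              \sum_(v \in [set: R]) f v = 1]].

(** The CW (weak) topology: U is open in |K| iff its trace on every closed
    simplex |sigma| (sigma a face) is open for the Euclidean topology of
    |sigma| (here expressed with the sup-distance of coordinates). *)
Definition cw_open (K : complex) (U : set (R -> R)) : Prop :=
  U `<=` realization K /\
  forall sigma, K sigma -> forall x, U x -> supp x `<=` sigma ->
    exists2 e : R, 0 < e & forall y, realization K y -> supp y `<=` sigma ->
      (forall v, `|x v - y v| < e) -> U y.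

Definition cw_continuous (K L : complex) (f : (R -> R) -> (R -> R)) : Prop :=
  (forall x, realization K x -> realization L (f x)) /\
  forall V, cw_open L V -> cw_open K [set x | realization K x /\ V (f x)].

(** homotopy between f, g : |K| -> |L|: a map H : |K| x [0,1] -> |L|,
    continuous for the product topology, with H(-,0) = f and H(-,1) = g. *)
Definition cw_homotopic (K L : complex) (f g : (R -> R) -> (R -> R)) : Prop :=
  exists H : (R -> R) -> R -> (R -> R),
  [/\ forall x, realization K x -> H x 0 = f x,
      forall x, realization K x -> H x 1 = g x,
      forall x t, realization K x -> 0 <= t <= 1 -> realization L (H x t) &
      forall V, cw_open L V -> forall x t, realization K x -> 0 <= t <= 1 ->
        V (H x t) ->
        exists U, [/\ cw_open K U, U x &
          (exists2 d : R, 0 < d & forall y s, U y -> 0 <= s <= 1 ->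
             `|s - t| < d -> V (H y s))]].

Definition cw_homotopy_equivalence (K L : complex) (f : (R -> R) -> (R -> R))
  : Prop :=
  cw_continuous K L f /\
  exists g, [/\ cw_continuous L K g,
               cw_homotopic K K (g \o f) id &
               cw_homotopic L L (f \o g) id].

Definition realize_map (phi : R -> R) (f : R -> R) : R -> R :=
  fun w => \sum_(v \in [set v | phi v = w]) f v.

End Defs.

(* Main.v *)
Require Import Defs.
From HB Require Import structures.
From mathcomp Require Import all_boot all_order all_algebra finmap.
From mathcomp Require Import lra.
From mathcomp Require Import boolp classical_sets functions cardinality fsbigop reals.
From mathcomp Require Import topology normedtype.
Set Implicit Arguments. Unset Strict Implicit. Unset Printing Implicit Defensive.
Import Order.TTheory GRing.Theory Num.Theory.
Import numFieldNormedType.Exports.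
Local Open Scope classical_set_scope.
Local Open Scope ring_scope.

(** Stretch the circle carrying [T_r X] to circumference [1 + 2r]. There [pi_r] is
    reduction modulo 1, so that [T_r X] is the preimage of [X], and two vertices are
    adjacent when their coordinates in [0, 1 + 2r) differ by at most [2r] or by at
    least [1]. A face [B] of the Cech complex lies in an arc of length [2r], and the
    full subcomplex of the Vietoris-Rips complex lying over [B] is a cone, whose apex
    [c B] is the first or the last point over [B] on that arc.

    A simplicial map [phi : K -> L] all of whose fibres over faces are cones is a
    homotopy equivalence. For [y] in [|L|] the superlevel sets [{y > s}] form a chain
    of faces, and their apexes span a face of [K]; the average over [s] of the apexes
    [c {y > s}] is a map [|L| -> |K|] whose composition with [phi] moves points only
    within their closed simplex. On [|K|], keeping the part [(h - t)^+] of [h] and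
    replacing the levels [s < t] of its image by the apexes [c {phi h > s}] gives,
    after normalization, a homotopy from the identity at [t = 0] to the other
    composition at [t = 1]. *)

Section FiniteSets.

Lemma finite_least {T : choiceType} (le : T -> T -> Prop) (A : set T) :
  (forall a, le a a) -> (forall b a c, le a b -> le b c -> le a c) ->
  finite_set A -> A !=set0 -> (forall a b, A a -> A b -> le a b \/ le b a) ->
  exists2 a, A a & forall b, A b -> le a b.
Proof.
move=> le_refl le_trans /finite_fsetP[X ->] [a Xa] le_total.
pose ord : rel X := fun b c => `[<le (val b) (val c)>].
case: (@extremumP _ _ ord [` Xa]%fset xpredT id) => //.
- by move=> b; apply/asboolP.
- by move=> b c d /asboolP cb /asboolP bd; apply/asboolP; exact: le_trans bd.
- move=> b c; apply/orP.
  by have [] := le_total _ _ (valP b) (valP c) => /asboolP; [left|right].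
move=> b _ bmin; exists (val b) => [|c Xc]; first exact: valP.
by have /asboolP := bmin [` Xc]%fset isT.
Qed.

Lemma finite_argmin {d} {T : choiceType} {R : orderType d} (f : T -> R) (A : set T) :
  finite_set A -> A !=set0 -> exists2 a, A a & forall b, A b -> (f a <= f b)%O.
Proof.
move=> Af A0; apply: finite_least => //.
  by move=> b a c; exact: le_trans.
by move=> a b _ _; apply/orP; exact: le_total.
Qed.

Definition chain {T : Type} (S : set (set T)) :=
  forall A B, S A -> S B -> A `<=` B \/ B `<=` A.

Lemma finite_chain_ind {T : Type} (P : set (set T) -> Prop) :
  P set0 ->
  (forall S M, (forall A, S A -> A `<=` M) -> P S -> P (M |` S)) ->
  forall S, finite_set S -> chain S -> P S.
Proof.
move=> P0 PU S /finite_fsetP[X ->]; elim/finSet_rect: X => X IH chainX.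
have [X0|/set0P X0] := eqVneq [set` X] set0; first by rewrite X0.
have [M XM Mmax] : exists2 M, [set` X] M & forall A, [set` X] A -> A `<=` M.
  apply: (finite_least (le := fun A B => B `<=` A)) => //.
  - by move=> A; exact: subset_refl.
  - by move=> B A C BA CB; exact: subset_trans BA.
  - by move=> A B XA XB; have [] := chainX A B XA XB; [right|left].
have XE : [set` X] = M |` [set` (X `\ M)%fset].
  apply/seteqP; split => [A /= XA|A /= [->//|]]; last by rewrite !inE => /andP[].
  by have [->|AM] := eqVneq A M; [left|right; rewrite /= !inE AM].
rewrite XE; apply: PU => [A|]; first by rewrite /= !inE => /andP[_ /Mmax].
apply: IH; first by rewrite fproperD1.
by move=> A B; rewrite /= !inE => /andP[_ ?] /andP[_ ?]; exact: chainX.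
Qed.

Lemma finite_powerset {T : choiceType} (W : set T) :
  finite_set W -> finite_set [set A | A `<=` W].
Proof.
move=> /finite_fsetP[X ->].
apply: (@sub_finite_set _ _ ((fun A : {fset T} => [set` A]) @` [set` fpowerset X])).
  move=> A AX; have Af : finite_set A by exact: sub_finite_set AX _.
  exists (fset_set A); last by rewrite fset_setK.
  by rewrite /= fpowersetE; apply/fsubsetP => a; rewrite in_fset_set // inE => /AX.
exact: finite_image.
Qed.

Lemma near_finite {I : Type} {T : choiceType} (F : set_system I) {FF : Filter F}
    (W : set T) (P : I -> T -> Prop) :
  finite_set W ->
  (forall v, W v -> \forall p \near F, P p v) ->
  \forall p \near F, forall v, W v -> P p v.
Proof.
move=> /finite_fsetP[X ->] FP.
have := @filter_bigI _ _ X (fun v p => P p v) F FF FP.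
by apply: filterS => p Pp v; exact: Pp.
Qed.

End FiniteSets.

Section FinitelySupported.
Context {R : realType}.
Implicit Types T : choiceType.

Definition support_set {T} (f : T -> R) : set T := [set v | f v != 0].

Lemma notin_support_set {T} (f : T -> R) (W : set T) v :
  support_set f `<=` W -> ~ W v -> f v = 0.
Proof. by move=> fW nWv; apply/eqP; apply: contra_notT nWv; exact: fW. Qed.

Lemma fsumr_support {T} (f : T -> R) (D W : set T) : support_set f `<=` W ->
  \sum_(v \in D) f v = \sum_(v \in D `&` W) f v.
Proof.
move=> fW; apply/esym/fsbig_widen => // v [Dv nDWv].
by apply: (notin_support_set fW) => Wv; exact: nDWv.
Qed.

Lemma fsumr_neq0_support {T} (f : T -> R) :
  \sum_(v \in [set: T]) f v != 0 -> support_set f !=set0.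
Proof. by move=> /(@fsbigN1 _ _ _ unit _ _ (fun=> f) tt)[v _ fv]; exists v. Qed.

Lemma fsumr_ge_term {T} (f : T -> R) (D : set T) v :
  finite_set (support_set f) -> (forall w, 0 <= f w) -> D v ->
  f v <= \sum_(w \in D) f w.
Proof.
move=> ff f0 Dv; have [->|fv] := eqVneq (f v) 0; first exact: fsumr_ge0.
rewrite (fsumr_support _ (@subset_refl _ _)) (fsbigD1 v) //=; last exact: finite_setIr.
by rewrite lerDl fsumr_ge0.
Qed.

Lemma fsumr_support_gt0 {T} (f : T -> R) :
  finite_set (support_set f) -> (forall v, 0 <= f v) -> support_set f !=set0 ->
  0 < \sum_(v \in [set: T]) f v.
Proof.
move=> ff f0 [v fv]; apply: lt_le_trans (fsumr_ge_term (v := v) ff f0 _) => //.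
by rewrite lt_neqAle eq_sym fv f0.
Qed.

Definition pushforward {T T'} (phi : T -> T') (f : T -> R) : T' -> R :=
  fun w => \sum_(v \in [set v | phi v = w]) f v.

Lemma pushforward_ge0 {T T'} (phi : T -> T') (f : T -> R) w :
  (forall v, 0 <= f v) -> 0 <= pushforward phi f w.
Proof. by move=> f0; exact: fsumr_ge0. Qed.

Lemma pushforward_ge {T T'} (phi : T -> T') (f : T -> R) v :
  finite_set (support_set f) -> (forall v, 0 <= f v) ->
  f v <= pushforward phi f (phi v).
Proof. by move=> ff f0; exact: fsumr_ge_term. Qed.

Lemma pushforward_support_sub {T T'} (phi : T -> T') (f : T -> R) :
  support_set (pushforward phi f) `<=` phi @` support_set f.
Proof.
by move=> w /(@fsbigN1 _ _ _ _ _ _ (fun=> f) w)[v vw fv]; exists v.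
Qed.

Lemma pushforward_support {T T'} (phi : T -> T') (f : T -> R) :
  finite_set (support_set f) -> (forall v, 0 <= f v) ->
  support_set (pushforward phi f) = phi @` support_set f.
Proof.
move=> ff f0; apply/seteqP; split; first exact: pushforward_support_sub.
move=> _ [v fv <-]; apply: lt0r_neq0; apply: lt_le_trans (pushforward_ge _ _ ff f0).
by rewrite lt_neqAle eq_sym fv f0.
Qed.

Lemma fsumr_pushforward {T T'} (phi : T -> T') (f : T -> R) :
  finite_set (support_set f) ->
  \sum_(w \in [set: T']) pushforward phi f w = \sum_(v \in [set: T]) f v.
Proof.
move=> ff; pose A := support_set f.
have pushE w : pushforward phi f w = \sum_(v \in A) (if phi v == w then f v else 0).
  rewrite /pushforward (fsumr_support _ (@subset_refl _ _)) setIC fsbig_mkcondr.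
  apply: eq_fsbigr => v _.
  by congr (if _ then _ else _); apply/idP/eqP; rewrite inE.
rewrite (fsumr_support _ (@pushforward_support_sub _ _ phi f)).
rewrite (fsumr_support _ (@subset_refl _ A)) !setTI; under eq_fsbigr do rewrite pushE.
rewrite exchange_fsbig //=; last exact: finite_image.
apply: eq_fsbigr => v /set_mem fv.
rewrite (fsbigD1 (phi v)) /=; [|exact: finite_image|by exists v].
by rewrite eqxx fsbig1 ?addr0 // => w [_ /eqP]; rewrite eq_sym => /negbTE->.
Qed.

Definition excess {T} (f : T -> R) (t : R) : T -> R := fun v => Num.max 0 (f v - t).

Lemma excess_ge0 {T} (f : T -> R) t v : 0 <= excess f t v.
Proof. by rewrite le_max lexx. Qed.

Lemma excess_support {T} (f : T -> R) t : support_set (excess f t) = [set v | t < f v].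
Proof.
apply/seteqP; split=> v; rewrite /support_set /excess /=.
  by rewrite ltNge; apply: contra => fvt; rewrite max_l ?subr_le0.
by move=> tfv; apply: lt0r_neq0; rewrite lt_max subr_gt0 tfv orbT.
Qed.

Lemma excess_support_sub {T} (f : T -> R) t :
  0 <= t -> support_set (excess f t) `<=` support_set f.
Proof.
by move=> t0 v; rewrite excess_support => /(le_lt_trans t0)/lt0r_neq0.
Qed.

Definition normalize {T} (f : T -> R) : T -> R :=
  (\sum_(w \in [set: T]) f w)^-1 \*o f.

Lemma normalize_support {T} (f : T -> R) :
  finite_set (support_set f) -> (forall v, 0 <= f v) ->
  support_set (normalize f) = support_set f.
Proof.
move=> ff f0; apply/seteqP; split => v; rewrite /support_set /= mulf_eq0 negb_or.
  by case/andP.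
by move=> fv; rewrite fv andbT invr_eq0 gt_eqF // fsumr_support_gt0 //; exists v.
Qed.

Lemma normalize_ge0 {T} (f : T -> R) v :
  (forall v, 0 <= f v) -> 0 <= normalize f v.
Proof. by move=> f0; rewrite mulr_ge0 // invr_ge0 fsumr_ge0. Qed.

Lemma fsumr_normalize {T} (f : T -> R) :
  finite_set (support_set f) -> (forall v, 0 <= f v) -> support_set f !=set0 ->
  \sum_(v \in [set: T]) normalize f v = 1.
Proof.
by move=> ff f0 fn; rewrite -mulr_fsumr mulVf // gt_eqF // fsumr_support_gt0.
Qed.

End FinitelySupported.

Section FinitelySupportedConvergence.
Context {R : realType}.
Implicit Types T : choiceType.

Lemma uniform_nbhsP {T} (f : T -> R) (P : set (T -> R)) :
  nbhs (f : {uniform T -> R}) P <->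
  exists2 e : R, 0 < e & forall g, (forall v, `|f v - g v| < e) -> P g.
Proof.
split=> [/uniform_nbhs[E []]|[e e0 eP]].
  rewrite -entourage_ballE => -[e e0 eE] EP.
  by exists e => [|g fg]; [exact: e0|apply: EP => v _; apply: eE; exact: fg].
apply/(@uniform_nbhs _ _ R f); exists [set xy | ball xy.1 e xy.2]; split.
  by rewrite -entourage_ballE; exists e.
by move=> g fg; apply: eP => v; exact: fg.
Qed.

Lemma uniform_cvgP {I : Type} {T} (F : set_system I) {FF : Filter F}
    (Y : I -> T -> R) (y : T -> R) :
  {uniform, Y @ F --> y} <->
  forall e, 0 < e -> \forall p \near F, forall v, `|y v - Y p v| < e.
Proof.
split=> [Yy e e0|Yy P /uniform_nbhsP[e e0 eP]].
  apply: (Yy [set f | forall v, `|y v - f v| < e]).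
  by apply/uniform_nbhsP; exists e.
by apply: filterS (Yy e e0) => p; exact: eP.
Qed.

Definition finsupp_cvg {I : Type} {T} (F : set_system I) (Y : I -> T -> R)
    (y : T -> R) :=
  exists W, [/\ finite_set W, support_set y `<=` W,
    \forall p \near F, support_set (Y p) `<=` W &
    forall v, Y p v @[p --> F] --> y v].

Section Operations.
Context {I : Type} {F : set_system I} {FF : Filter F}.

Lemma finsupp_cvg_uniform {T} (Y : I -> T -> R) y :
  finsupp_cvg F Y y -> {uniform, Y @ F --> y}.
Proof.
move=> [W [Wf yW YW Yy]]; apply/uniform_cvgP => e e0.
have : \forall p \near F, forall v, W v -> `|y v - Y p v| < e.
  by apply: near_finite => // v _; move/cvgrPdist_lt: (Yy v); exact.
apply: filterS2 YW => p YpW close v; have [/close//|nWv] := pselect (W v).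
by rewrite (notin_support_set yW) // (notin_support_set YpW) // subrr normr0.
Qed.

Lemma finsupp_cvg_cst {T} (y : T -> R) :
  finite_set (support_set y) -> finsupp_cvg F (fun=> y) y.
Proof.
move=> yf; exists (support_set y); split=> // [|v]; last exact: cvg_cst.
by apply: filterE => _; exact: subset_refl.
Qed.

Lemma finsupp_cvgD {T} (Y Z : I -> T -> R) y z :
  finsupp_cvg F Y y -> finsupp_cvg F Z z ->
  finsupp_cvg F (fun p => Y p \+ Z p) (y \+ z).
Proof.
have supportD (f g : T -> R) W V : support_set f `<=` W -> support_set g `<=` V ->
    support_set (f \+ g) `<=` W `|` V.
  move=> fW gV v; rewrite /support_set /=.
  have [->|/fW] := eqVneq (f v) 0; last by left.
  by rewrite add0r => /gV; right.
move=> [W [Wf yW YW Yy]] [V [Vf zV ZV Zz]]; exists (W `|` V); split.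
- by rewrite finite_setU.
- exact: supportD.
- by apply: filterS2 YW ZV => p; exact: supportD.
- by move=> v; exact: cvgD.
Qed.

Lemma finsupp_cvgZ {T} (a : I -> R) (b : R) (Y : I -> T -> R) y :
  a @ F --> b -> finsupp_cvg F Y y ->
  finsupp_cvg F (fun p => a p \*o Y p) (b \*o y).
Proof.
have supportZ c (f : T -> R) W : support_set f `<=` W -> support_set (c \*o f) `<=` W.
  by move=> fW v; rewrite /support_set /= mulf_eq0 negb_or => /andP[_ /fW].
move=> ab [W [Wf yW YW Yy]]; exists W; split=> //; first exact: supportZ.
  by apply: filterS YW => p; exact: supportZ.
by move=> v; exact: cvgM.
Qed.

Lemma finsupp_cvg_sum {T} (D : set T) (Y : I -> T -> R) y : finsupp_cvg F Y y ->
  \sum_(v \in D) Y p v @[p --> F] --> \sum_(v \in D) y v.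
Proof.
move=> [W [Wf yW YW Yy]].
have DWf : finite_set (D `&` W) by exact: finite_setIr.
rewrite (fsumr_support _ yW) fsbig_finite //.
apply: (@cvg_trans _ (\sum_(v <- fset_set (D `&` W)) Y p v @[p --> F])).
  apply: near_eq_cvg; apply: filterS YW => p YpW.
  by rewrite (fsumr_support _ YpW) fsbig_finite.
by apply: cvg_big => //; exact: add_continuous.
Qed.

Lemma finsupp_cvg_normalize {T} (Y : I -> T -> R) y :
  \sum_(v \in [set: T]) y v != 0 -> finsupp_cvg F Y y ->
  finsupp_cvg F (fun p => normalize (Y p)) (normalize y).
Proof.
by move=> y0 Yy; apply: finsupp_cvgZ => //; apply: cvgV => //; exact: finsupp_cvg_sum.
Qed.

Lemma finsupp_cvg_pushforward {T T' : choiceType} (phi : T -> T') (Y : I -> T -> R) y :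
  finsupp_cvg F Y y ->
  finsupp_cvg F (fun p => pushforward phi (Y p)) (pushforward phi y).
Proof.
have pushW (f : T -> R) W : support_set f `<=` W ->
    support_set (pushforward phi f) `<=` phi @` W.
  by move=> fW w /pushforward_support_sub[v /fW Wv <-]; exists v.
move=> [W [Wf yW YW Yy]]; exists (phi @` W); split.
- exact: finite_image.
- exact: pushW.
- by apply: filterS YW => p; exact: pushW.
- by move=> w; apply: finsupp_cvg_sum; exists W.
Qed.

Lemma finsupp_cvg_excess {T} (Y : I -> T -> R) y (S : I -> R) (t : R) :
  0 <= t -> (\forall p \near F, 0 <= S p) -> S @ F --> t -> finsupp_cvg F Y y ->
  finsupp_cvg F (fun p => excess (Y p) (S p)) (excess y t).
Proof.
move=> t0 S0 St [W [Wf yW YW Yy]]; exists W; split=> //.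
- exact: subset_trans (excess_support_sub t0) yW.
- apply: filterS2 S0 YW => p Sp0 YpW.
  exact: subset_trans (excess_support_sub Sp0) YpW.
- move=> v; rewrite /excess.
  apply: (continuous_cvg FF (h := fun x : R^o => Num.max 0 x)).
    by apply: (@continuous_max _ _ (cst 0) id) => //; exact: cst_continuous.
  exact: cvgB.
Qed.

End Operations.
End FinitelySupportedConvergence.

Section Levels.
Context {R : realType} {T : choiceType}.
Implicit Types (A B : set T) (y : T -> R) (s t : R).

Lemma inf_image_le {I : Type} (D : set I) (f g : I -> R) e :
  D !=set0 -> has_lbound (f @` D) -> (forall i, D i -> f i <= g i + e) ->
  inf (f @` D) <= inf (g @` D) + e.
Proof.
move=> [i Di] flb fg; rewrite -lerBlDr; apply: lb_le_inf; first by exists (g i), i.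
move=> _ [j Dj <-]; rewrite lerBlDr; apply: le_trans (fg j Dj).
by apply: ge_inf => //; exists j.
Qed.

Definition level_gap y t A (ab : T * T) : R :=
  Num.max 0 (Num.min t (y ab.1) - y ab.2 *+ (ab.2 \notin A)).

(* For finitely supported [y >= 0] and nonempty [A], the length of the set of
   all [0 <= s < t] with [A = {v | y v > s}]. *)
Definition level y t A : R := inf (level_gap y t A @` (A `*` setT)).

Lemma level_gap_ge0 y t A ab : 0 <= level_gap y t A ab.
Proof. by rewrite le_max lexx. Qed.

Lemma level_gaps_lbound y t A : has_lbound (level_gap y t A @` (A `*` setT)).
Proof. by exists 0 => _ [ab _ <-]; exact: level_gap_ge0. Qed.

Lemma level_set0 y t : level y t set0 = 0.
Proof. by rewrite /level set0X image_set0 inf0. Qed.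

Lemma level_ge0 y t A : 0 <= level y t A.
Proof.
have [->|/set0P[a Aa]] := eqVneq A set0; first by rewrite level_set0.
apply: lb_le_inf; first by exists (level_gap y t A (a, a)); exists (a, a).
by move=> _ [ab _ <-]; exact: level_gap_ge0.
Qed.

Lemma level_neq0_gap y t A a b : level y t A != 0 -> A a ->
  y b *+ (b \notin A) < Num.min t (y a).
Proof.
move=> lA Aa; have : 0 < level y t A by rewrite lt_neqAle eq_sym lA level_ge0.
move=> /lt_le_trans/(_ (ge_inf (level_gaps_lbound y t A) _)).
move=> /(_ (level_gap y t A (a, b)))/=.
rewrite lt_max ltxx subr_gt0; apply; by exists (a, b).
Qed.

Lemma level_neq0_nonempty y t A : level y t A != 0 -> A !=set0.
Proof. by move=> lA; apply/set0P; apply: contra_neq lA => ->; exact: level_set0. Qed.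

Lemma level_neq0_lt y t A a b : level y t A != 0 -> A a -> ~ A b ->
  y b < Num.min t (y a).
Proof. by move=> lA Aa nAb; have := level_neq0_gap b lA Aa; rewrite memNset. Qed.

Lemma level_neq0_gt0 y t A a : level y t A != 0 -> A a -> 0 < Num.min t (y a).
Proof. by move=> lA Aa; have := level_neq0_gap a lA Aa; rewrite mem_set. Qed.

Lemma level_neq0_support y t A : level y t A != 0 -> A `<=` support_set y.
Proof.
by move=> lA a /(level_neq0_gt0 lA); rewrite lt_min => /andP[_ /lt0r_neq0].
Qed.

Lemma finite_level_support y t :
  finite_set (support_set y) -> finite_set (support_set (level y t)).
Proof.
by move=> /finite_powerset; apply: sub_finite_set => A; exact: level_neq0_support.
Qed.

Lemma chain_level_support y t : chain (support_set (level y t)).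
Proof.
move=> A B lA lB; apply: contrapT => /not_orP[].
move=> /existsNP[a /not_implyP[Aa nBa]] /existsNP[b /not_implyP[Bb nAb]].
have := level_neq0_lt lA Aa nAb; have := level_neq0_lt lB Bb nBa.
by rewrite !lt_min => /andP[_ yab] /andP[_ /(lt_trans yab)]; rewrite ltxx.
Qed.

Lemma level_support_neq0 y t : finite_set (support_set y) -> support_set y !=set0 ->
  (forall v, 0 <= y v) -> 0 < t -> level y t (support_set y) != 0.
Proof.
move=> yf y_neq0 y0 t0; have [a ya amin] := finite_argmin y yf y_neq0.
have a0 : 0 < y a by rewrite lt_neqAle eq_sym ya y0.
apply: lt0r_neq0; apply: (@lt_le_trans _ _ (Num.min t (y a))).
  by rewrite lt_min t0.
apply: lb_le_inf; first by exists (level_gap y t (support_set y) (a, a)), (a, a).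
move=> _ [[b c] [yb _] <-]; rewrite /level_gap /=.
have -> : y c *+ (c \notin support_set y) = 0.
  by case: (boolP (c \in _)) => //=; rewrite notin_setE => /negP/negPn/eqP.
rewrite subr0 le_max; apply/orP; right.
by rewrite le_min !ge_min lexx /= amin // orbT.
Qed.

Lemma level_gap_le y z s t A d ab : (forall v, `|y v - z v| <= d) -> `|s - t| <= d ->
  level_gap y s A ab <= level_gap z t A ab + (d + d).
Proof.
case: ab => a b yz; rewrite ler_norml => /andP[std1 std2].
have /[!ler_norml]/andP[ya1 ya2] := yz a; have /[!ler_norml]/andP[yb1 yb2] := yz b.
rewrite /level_gap /=; set p := _ *+ _; set q := _ *+ _.
have qp : q <= p + d by rewrite /p /q; case: (_ \notin _); rewrite ?mulr1n ?mulr0n; lra.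
have minst : Num.min s (y a) <= Num.min t (z a) + d.
  by case: (leP s) => ?; case: (leP t) => ?; lra.
case: (lerP 0 (Num.min s (y a) - p)) => ?;
  by case: (lerP 0 (Num.min t (z a) - q)) => ?; lra.
Qed.

Lemma ler_dist_level y z s t A d : (forall v, `|y v - z v| <= d) -> `|s - t| <= d ->
  `|level y s A - level z t A| <= d + d.
Proof.
move=> yz st; have d0 : 0 <= d := le_trans (normr_ge0 _) st.
have [->|/set0P[a Aa]] := eqVneq A set0.
  by rewrite !level_set0 subrr normr0 addr_ge0.
have level_le x x' r r' : (forall v, `|x v - x' v| <= d) -> `|r - r'| <= d ->
    level x r A <= level x' r' A + (d + d).
  move=> xx' rr'; apply: inf_image_le; first by exists (a, a).
    exact: level_gaps_lbound.
  by move=> ab _; exact: level_gap_le.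
rewrite ler_distl; apply/andP; split; last exact: level_le.
by rewrite lerBlDr; apply: level_le => [v|]; rewrite distrC.
Qed.

Lemma finsupp_cvg_level {I : Type} (F : set_system I) (Y : I -> T -> R) (S : I -> R)
    y t : Filter F ->
  finsupp_cvg F Y y -> S @ F --> t ->
  finsupp_cvg F (fun p => level (Y p) (S p)) (level y t).
Proof.
move=> FF Yy St.
have Yunif := [elaborate (uniform_cvgP Y y).1 (finsupp_cvg_uniform Yy)].
have [W [Wf yW YW _]] := Yy; exists [set A | A `<=` W]; split.
- exact: finite_powerset.
- by move=> A /level_neq0_support Ay; exact: subset_trans yW.
- by apply: filterS YW => p YpW A /level_neq0_support Ap; exact: subset_trans YpW.
- move=> A; apply/cvgrPdist_le => e e0; have e2 : 0 < e / 2 by rewrite divr_gt0.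
  have /cvgrPdist_lt/(_ _ e2) Snear := St.
  apply: filterS2 (Yunif _ e2) Snear => p Yp Sp.
  by rewrite [leRHS]splitr; apply: ler_dist_level => [v|]; exact: ltW.
Qed.

End Levels.

Section CellContinuity.
Context {R : realType}.
Implicit Types (K L : complex R) (A W : set R) (x y : R -> R) (s t : R).

Record is_complex K : Prop := IsComplex {
  face_finite : forall A, K A -> finite_set A;
  face_subset : forall A B, K A -> B `<=` A -> B !=set0 -> K B }.

Definition closed_simplex K A : set (R -> R) :=
  [set x | realization K x /\ supp x `<=` A].

Lemma realization_closed_simplex K x :
  realization K x -> closed_simplex K (supp x) x.
Proof. by move=> Kx; split. Qed.

Lemma realization_finite K x : is_complex K -> realization K x -> finite_set (supp x).
Proof. by move=> Kc [/(face_finite Kc)]. Qed.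

Lemma realization_le1 K x v : is_complex K -> realization K x -> x v <= 1.
Proof.
move=> Kc Kx; have [_ x0 <-] := Kx; apply: fsumr_ge_term => //.
exact: realization_finite Kx.
Qed.

Lemma realization_support_neq0 K x : realization K x -> supp x !=set0.
Proof.
by move=> [_ _ x1]; apply: fsumr_neq0_support; rewrite x1 oner_neq0.
Qed.

Definition simplex_nbhs K A x : set_system (R -> R) :=
  within (closed_simplex K A) (nbhs (x : {uniform R -> R})).

Global Instance simplex_nbhs_filter K A x : Filter (simplex_nbhs K A x).
Proof. exact: within_filter. Qed.

Lemma near_closed_simplex K A x :
  \forall y \near simplex_nbhs K A x, closed_simplex K A y.
Proof. exact: withinT. Qed.

Lemma cw_openP K U : cw_open K U <-> U `<=` realization K /\
  forall A x, K A -> U x -> supp x `<=` A -> simplex_nbhs K A x U.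
Proof.
split=> -[UK Uo]; split=> // A.
  move=> x KA Ux xA; have [e e0 eU] := Uo _ KA _ Ux xA.
  by apply/uniform_nbhsP; exists e => // y xy [Ky yA]; exact: eU.
move=> KA x Ux xA; have /uniform_nbhsP[e e0 eU] := Uo _ _ KA Ux xA.
by exists e => // y Ky yA xy; exact: eU.
Qed.

Lemma near_supp_sub x : finite_set (supp x) ->
  \forall y \near (x : {uniform R -> R}), supp x `<=` supp y.
Proof.
move=> xf; have := near_finite (F := nbhs (x : {uniform R -> R})) (P := @supp R) xf.
apply=> v xv; apply/uniform_nbhsP.
exists `|x v|; first by rewrite normr_gt0.
move=> y xy; apply/negP => /eqP yv.
by have := xy v; rewrite yv subr0 ltxx.
Qed.

Lemma cw_open_simplex_nbhs K U W x : is_complex K -> cw_open K U -> U x ->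
  finite_set W -> simplex_nbhs K W x U.
Proof.
move=> Kc /cw_openP[UK Uo] Ux Wf.
have near_face : \forall y \near (x : {uniform R -> R}), forall B, B `<=` W ->
    K B -> supp x `<=` B -> closed_simplex K B y -> U y.
  apply: (near_finite (F := nbhs (x : {uniform R -> R}))).
    exact: finite_powerset.
  move=> B _; have [KB|?] := pselect (K B); last by apply: nearW.
  have [xB|?] := pselect (supp x `<=` B); last by apply: nearW.
  have := Uo _ _ KB Ux xB; rewrite /simplex_nbhs /within /=.
  by apply: filterS => y Uy _ _; exact: Uy.
apply: filterS2 near_face (near_supp_sub (realization_finite Kc (UK _ Ux))).
move=> y Uy xy [Ky yW]; apply: (Uy (supp y)) => //; first by case: Ky.
exact: realization_closed_simplex.
Qed.

Definition unit_interval : set R := [set t | 0 <= t <= 1].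

Definition cell_nbhs K A x t : set_system ((R -> R) * R) :=
  filter_prod (simplex_nbhs K A x) (within unit_interval (nbhs t)).

Lemma near_cell K A x t :
  \forall p \near cell_nbhs K A x t, closed_simplex K A p.1 /\ 0 <= p.2 <= 1.
Proof.
exists (closed_simplex K A, unit_interval) => /=.
  by split; [exact: near_closed_simplex|exact: withinT].
by move=> [y s].
Qed.

Lemma cvg_cell_snd K A x t : p.2 @[p --> cell_nbhs K A x t] --> t.
Proof. by apply: cvg_trans; [exact: cvg_snd|exact: cvg_within]. Qed.

Lemma finsupp_cvg_cell_fst K A x t : finite_set A -> supp x `<=` A ->
  finsupp_cvg (cell_nbhs K A x t) fst x.
Proof.
move=> Af xA; exists A; split=> // [|v].
  by apply: filterS (near_cell K A x t) => p [[]].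
apply/cvgrPdist_lt => e e0; exists ([set y | `|x v - y v| < e], setT) => /=.
  split; last exact: filterT.
  by apply/uniform_nbhsP; exists e => // y xy _; exact: xy.
by move=> p [].
Qed.

(* A family of maps [F _ t : |K| -> |L|], for [t] in [0, 1], whose restriction to
   each closed simplex of [K] is continuous in the coordinates of [|L|], locally
   with values in finitely many coordinates. *)
Definition cell_continuous K L (F : (R -> R) -> R -> (R -> R)) :=
  (forall x t, realization K x -> 0 <= t <= 1 -> realization L (F x t)) /\
  forall A x t, K A -> closed_simplex K A x -> 0 <= t <= 1 ->
    finsupp_cvg (cell_nbhs K A x t) (fun p => F p.1 p.2) (F x t).

Section Families.
Variables (K L : complex R) (F : (R -> R) -> R -> (R -> R)).
Hypotheses (Lc : is_complex L) (Fc : cell_continuous K L F).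

Lemma near_cell_continuous V A x t : cw_open L V -> K A -> closed_simplex K A x ->
  0 <= t <= 1 -> V (F x t) -> \forall p \near cell_nbhs K A x t, V (F p.1 p.2).
Proof.
move=> Vo KA xA t01 VF; have [FL Fcvg] := Fc.
have cvgF := Fcvg A x t KA xA t01; have [W [Wf _ FW _]] := cvgF.
have near_V : \forall p \near cell_nbhs K A x t,
    closed_simplex L W (F p.1 p.2) -> V (F p.1 p.2).
  exact: (finsupp_cvg_uniform cvgF) (cw_open_simplex_nbhs Lc Vo VF Wf).
apply: filterS3 near_V FW (near_cell K A x t) => p Vp FpW [[Kp _] p01].
by apply: Vp; split=> //; exact: FL.
Qed.

Lemma cw_open_tube V (J : set R) :
  cw_open L V -> compact J -> J `<=` unit_interval ->
  cw_open K [set x | realization K x /\ forall t, J t -> V (F x t)].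
Proof.
move=> Vo Jc J01; apply/cw_openP; split=> [x []//|A x KA [Kx VF] xA].
have /compact_near_coveringP/near_covering_withinP coverJ := Jc.
have near_J : \forall y \near simplex_nbhs K A x, forall t, J t -> V (F y t).
  apply: coverJ => t Jt.
  have [[P Q] /= [Px Qt] PQ] :=
    near_cell_continuous Vo KA (conj Kx xA) (J01 t Jt) (VF t Jt).
  exists ([set s | unit_interval s -> Q s], P) => //=.
  by move=> [s y] [/= Qs Py] /J01 s01; apply: (PQ (y, s)); split=> //=; exact: Qs.
by apply: filterS2 near_J (near_closed_simplex K A x) => y yV [Ky _].
Qed.

Lemma cell_continuous_homotopic f g :
  (forall x, realization K x -> F x 0 = f x) ->
  (forall x, realization K x -> F x 1 = g x) -> cw_homotopic K L f g.
Proof.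
move=> F0 F1; exists F; split=> // [|V Vo x t Kx t01 VF]; first by case: Fc.
have [suppK _ _] := Kx; have x_simplex := realization_closed_simplex Kx.
have [[P Q] /= [Px /nbhs_ballP[d /= d0 dQ]] PQ] :=
  near_cell_continuous Vo suppK x_simplex t01 VF.
pose J := `[Num.max 0 (t - d / 2), Num.min 1 (t + d / 2)]%classic.
have J01 : J `<=` unit_interval.
  move=> s; rewrite /J /= in_itv /= ge_max le_min.
  by move=> /andP[/andP[s0 _] /andP[s1 _]]; apply/andP.
exists [set y | realization K y /\ forall s, J s -> V (F y s)]; split.
- by apply: cw_open_tube => //; exact: segment_compact.
- split=> // s Js; apply: (PQ (x, s)); split=> /=.
    exact: (nbhs_singleton Px x_simplex).
  apply: dQ; last exact: J01.
  move: Js; rewrite /J /= in_itv /= ge_max le_min => /andP[/andP[_ ?] /andP[_ ?]].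
  by rewrite /ball /= ltr_norml; apply/andP; split; lra.
- exists (d / 2); first by rewrite divr_gt0.
  move=> y s [Ky yV] /andP[s0 s1]; rewrite ltr_norml => /andP[? ?]; apply: yV.
  by rewrite /J /= in_itv /= ge_max le_min s0 s1 /=; apply/andP; split; lra.
Qed.

Lemma cell_continuous_cw t : 0 <= t <= 1 -> cw_continuous K L (F ^~ t).
Proof.
move=> t01; split=> [x Kx|V Vo]; first by case: Fc => + _; exact.
apply/cw_openP; split=> [x []//|A x KA [Kx VF] xA].
have [[P Q] /= [Px Qt] PQ] := near_cell_continuous Vo KA (conj Kx xA) t01 VF.
apply: filterS2 Px (near_closed_simplex K A x) => y Py [Ky _]; split=> //.
by apply: (PQ (y, t)); split=> //=; exact: nbhs_singleton Qt t01.
Qed.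

End Families.
End CellContinuity.

Section Realizations.
Context {R : realType}.
Implicit Types (K L : complex R) (x y : R -> R).

Lemma pushforward_realization K L (phi : R -> R) x : is_complex K ->
  simplicial K L phi -> realization K x -> realization L (pushforward phi x).
Proof.
move=> Kc phiS Kx; have [suppK x0 x1] := Kx; have xf := realization_finite Kc Kx.
split.
- have -> : supp (pushforward phi x) = phi @` supp x by exact: pushforward_support.
  exact: phiS.
- by move=> w; exact: pushforward_ge0.
- by rewrite fsumr_pushforward.
Qed.

Lemma normalize_realization K x : is_complex K ->
  K (supp x) -> (forall v, 0 <= x v) -> supp x !=set0 -> realization K (normalize x).
Proof.
move=> Kc Kx x0 xn; have xf := face_finite Kc Kx; split.
- by have -> : supp (normalize x) = supp x by exact: normalize_support.
- by move=> v; exact: normalize_ge0.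
- exact: fsumr_normalize.
Qed.

Lemma normalize_id K x : realization K x -> normalize x = x.
Proof.
by move=> [_ _ x1]; apply/funext => v; rewrite /normalize /= x1 invr1 mul1r.
Qed.

Definition segment x y (t : R) : R -> R := (1 - t) \*o x \+ t \*o y.

Lemma segment_realization K x y t :
  is_complex K -> realization K x -> realization K y ->
  supp x `<=` supp y -> 0 <= t <= 1 -> realization K (segment x y t).
Proof.
move=> Kc Kx Ky xy /andP[t0 t1]; have [_ x0 x1] := Kx; have [yK y0 y1] := Ky.
have yf := realization_finite Kc Ky.
have segment_y : supp (segment x y t) `<=` supp y.
  move=> v; rewrite /supp /segment /=; apply: contra_neq => yv.
  by rewrite yv (notin_support_set xy) ?mulr0 ?addr0 // => /negP; rewrite yv eqxx.
have segment1 : \sum_(v \in [set: R]) segment x y t v = 1.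
  rewrite (fsumr_support _ segment_y) setTI fsbig_split //= -!mulr_fsumr.
  move: x1 y1; rewrite (fsumr_support _ xy) (fsumr_support _ (@subset_refl _ (supp y))).
  by rewrite !setTI => -> ->; lra.
split=> //; last by move=> v; rewrite addr_ge0 // mulr_ge0 // subr_ge0.
apply: (face_subset Kc yK segment_y).
by apply: fsumr_neq0_support; rewrite segment1 oner_neq0.
Qed.

End Realizations.

Section Apexes.
Context {R : realType}.
Implicit Types (K : complex R) (A B : set R).

Definition augment K : complex R := [set A | A = set0 \/ K A].

Lemma augment_subset K A B : is_complex K -> augment K A -> B `<=` A -> augment K B.
Proof.
move=> Kc KA BA; have [->|/set0P B0] := eqVneq B set0; [by left|right].
case: KA => [A0|KA]; last exact: face_subset KA BA B0.
by case: B0 => b /BA; rewrite A0.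
Qed.

Lemma augment_finite K A : is_complex K -> augment K A -> finite_set A.
Proof. by move=> Kc [->|]; [exact: finite_set0|exact: face_finite]. Qed.

(* The full subcomplex of [K] on the vertices over [B] is a cone with apex [a]. *)
Definition is_apex K (phi : R -> R) B (a : R) :=
  B (phi a) /\ forall A, augment K A -> phi @` A `<=` B -> K (a |` A).

End Apexes.

Section ConeFibres.
Context {R : realType} (K L : complex R) (phi : R -> R) (c : set R -> R).
Hypotheses (Kc : is_complex K) (Lc : is_complex L) (phiS : simplicial K L phi).
Hypothesis c_apex : forall B, L B -> is_apex K phi B (c B).
Implicit Types (A B : set R) (x y h : R -> R) (t : R).

Lemma chain_apexes_face S A : finite_set S -> chain S ->
  (forall B, S B -> L B /\ phi @` A `<=` B) -> augment K A ->
  augment K (A `|` c @` S).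
Proof.
move=> Sf Schain SL KA; move: S Sf Schain SL.
apply: finite_chain_ind => [_|S M Smax IH SL].
  by rewrite image_set0 setU0.
have S_over B : S B -> L B /\ phi @` A `<=` B by move=> SB; apply: SL; right.
have [LM AM] := SL M (or_introl erefl); have [_ coneM] := c_apex LM.
rewrite image_setU image_set1 setUCA; right; apply: coneM; first exact: IH.
move=> _ [v [Av|[B SB <-]] <-]; first by apply: AM; exists v.
by apply: (Smax B SB); have [/c_apex[]] := S_over B SB.
Qed.

Lemma level_neq0_face y t B : realization L y -> level y t B != 0 -> L B.
Proof.
move=> [Ly _ _] lB.
exact: (face_subset Lc Ly (level_neq0_support lB) (level_neq0_nonempty lB)).
Qed.

(* The average, over the levels [s] below [t], of the apexes [c {y > s}],
   completed by the part of [h] above [t]. *)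
Definition blend y h t : R -> R := pushforward c (level y t) \+ excess h t.

Lemma blend_ge0 y h t v : 0 <= blend y h t v.
Proof.
by rewrite addr_ge0 ?excess_ge0 // pushforward_ge0 // => B; exact: level_ge0.
Qed.

Lemma blend_support y h t : finite_set (supp y) ->
  supp (blend y h t) = [set v | t < h v] `|` c @` support_set (level y t).
Proof.
move=> yf; have lower0 v : 0 <= pushforward c (level y t) v.
  by apply: pushforward_ge0 => B; exact: level_ge0.
rewrite -(pushforward_support c (finite_level_support t yf)); last exact: level_ge0.
rewrite -excess_support; apply/seteqP; split=> v; rewrite /supp /support_set /blend /=.
  by rewrite paddr_eq0 ?excess_ge0 // negb_and => /orP[]; [right|left].
by rewrite paddr_eq0 ?excess_ge0 // negb_and => -[|] ->; rewrite ?orbT.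
Qed.

Lemma blend_face y h t : realization L y -> augment K (supp h) ->
  (forall v, h v <= y (phi v)) -> 0 <= t -> augment K (supp (blend y h t)).
Proof.
move=> Ly Kh hy t0; have yf := realization_finite Lc Ly.
rewrite blend_support //; apply: chain_apexes_face.
- exact: finite_level_support.
- exact: chain_level_support.
- move=> B lB; split=> [|_ [v /= thv <-]]; first exact: level_neq0_face lB.
  have [b Bb] := level_neq0_nonempty lB; apply: contrapT => nBv.
  have := level_neq0_lt lB Bb nBv; rewrite lt_min => /andP[yt _].
  by have := lt_trans yt thv; rewrite ltNge hy.
- apply: augment_subset Kh _ => //; rewrite -excess_support.
  exact: excess_support_sub.
Qed.

Lemma blend_support_neq0 y h t : realization L y ->
  0 < t \/ (exists v, t < h v) -> supp (blend y h t) !=set0.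
Proof.
move=> Ly th; have yf := realization_finite Lc Ly; rewrite blend_support //.
case: th => [t0|[v thv]]; last by exists v; left.
exists (c (supp y)); right; exists (supp y) => //.
by apply: level_support_neq0 => //; [exact: realization_support_neq0 Ly|case: Ly].
Qed.

Section NormalizedBlend.
Variables (y h : R -> R) (t : R).
Hypotheses (Ly : realization L y) (Kh : augment K (supp h)).
Hypotheses (hy : forall v, h v <= y (phi v)) (t_ge0 : 0 <= t).
Hypothesis gt0_or_excess : 0 < t \/ exists v, t < h v.

Lemma normalize_blend_realization : realization K (normalize (blend y h t)).
Proof.
have blend_neq0 := blend_support_neq0 Ly gt0_or_excess.
apply: normalize_realization => //; last exact: blend_ge0.
by case: (blend_face Ly Kh hy t_ge0) => // blend0; case: blend_neq0; rewrite blend0.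
Qed.

Lemma finsupp_cvg_normalize_blend {I : Type} (F : set_system I)
    (Y H : I -> R -> R) (S : I -> R) : Filter F ->
  (\forall p \near F, 0 <= S p) ->
  finsupp_cvg F Y y -> finsupp_cvg F H h -> S @ F --> t ->
  finsupp_cvg F (fun p => normalize (blend (Y p) (H p) (S p)))
    (normalize (blend y h t)).
Proof.
move=> FF S0 Yy Hh St; apply: finsupp_cvg_normalize.
  rewrite gt_eqF // fsumr_support_gt0 //.
  - exact: augment_finite (blend_face Ly Kh hy t_ge0).
  - exact: blend_ge0.
  - exact: blend_support_neq0.
apply: finsupp_cvgD; last exact: finsupp_cvg_excess.
by apply: finsupp_cvg_pushforward; exact: finsupp_cvg_level.
Qed.

End NormalizedBlend.

Definition apex_section y : R -> R := normalize (blend y (fun=> 0) 1).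

Let supp0 : supp (fun=> 0 : R) = set0.
Proof. by apply/seteqP; split=> // v; rewrite /supp /= eqxx. Qed.

Let augment_supp0 : augment K (supp (fun=> 0 : R)).
Proof. by left. Qed.

Lemma apex_section_realization y : realization L y -> realization K (apex_section y).
Proof.
move=> Ly; apply: normalize_blend_realization => //; last by left.
by move=> v; case: Ly.
Qed.

Lemma cell_continuous_apex_section : cell_continuous L K (fun y _ => apex_section y).
Proof.
split=> [y t Ly _|A y t LA [Ly yA] _]; first exact: apex_section_realization.
apply: finsupp_cvg_normalize_blend => //.
- by move=> v; case: Ly.
- by left.
- by apply: filterE => p.
- by apply: finsupp_cvg_cell_fst => //; exact: face_finite LA.
- by apply: finsupp_cvg_cst; rewrite [support_set _]supp0.
- exact: cvg_cst.
Qed.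

Lemma image_apex_section_support y : realization L y ->
  supp (pushforward phi (apex_section y)) `<=` supp y.
Proof.
move=> Ly w /pushforward_support_sub[v vs <-]; have yf := realization_finite Lc Ly.
have blend_finite : finite_set (supp (blend y (fun=> 0) 1)).
  by apply: augment_finite (blend_face Ly augment_supp0 _ ler01) => // u; case: Ly.
move: vs; rewrite normalize_support //; last exact: blend_ge0.
rewrite [support_set _]blend_support // => -[/=|[B lB <-]]; first by rewrite ltr10.
by have [Bc _] := c_apex (level_neq0_face Ly lB); exact: (level_neq0_support lB).
Qed.

Lemma cell_continuous_segment_to_id :
  cell_continuous L L (fun y t => segment (pushforward phi (apex_section y)) y t).
Proof.
split=> [y t Ly t01|A y t LA yA t01].
  apply: segment_realization => //; last exact: image_apex_section_support.
  exact: pushforward_realization (apex_section_realization Ly).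
have cvg_time := @cvg_cell_snd _ L A y t.
apply: finsupp_cvgD; apply: finsupp_cvgZ => //.
- by apply: cvgB => //; exact: cvg_cst.
- apply: finsupp_cvg_pushforward.
  by have [_ /(_ A y t)] := cell_continuous_apex_section; exact.
- by case: yA => _ yA; apply: finsupp_cvg_cell_fst => //; exact: face_finite LA.
Qed.

Definition collapse h t : R -> R := normalize (blend (pushforward phi h) h t).

Let augment_supp h : realization K h -> augment K (supp h).
Proof. by case; right. Qed.

Let le_pushforward h v : realization K h -> h v <= pushforward phi h (phi v).
Proof.
by move=> Kh; apply: pushforward_ge; [exact: realization_finite Kh|case: Kh].
Qed.

Let gt0_or_excess h t : realization K h -> 0 <= t -> 0 < t \/ exists v, t < h v.
Proof.
move=> Kh; rewrite le_eqVlt => /predU1P[<-|]; [right|by left].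
have [v hv] := realization_support_neq0 Kh; exists v.
by have [_ h0 _] := Kh; rewrite lt_neqAle eq_sym hv h0.
Qed.

Lemma collapse_realization h t : realization K h -> 0 <= t ->
  realization K (collapse h t).
Proof.
move=> Kh t0; apply: normalize_blend_realization => //.
- exact: pushforward_realization Kc phiS Kh.
- exact: augment_supp.
- by move=> v; exact: le_pushforward.
- exact: gt0_or_excess.
Qed.

Lemma collapse0 h : realization K h -> collapse h 0 = h.
Proof.
move=> Kh; rewrite -[RHS](normalize_id Kh); congr normalize; apply/funext => v.
rewrite /blend /excess /= subr0 max_r; last by case: Kh.
rewrite [X in X + _](_ : _ = 0) ?add0r //; apply: fsbig1 => B _.
apply/eqP; apply/negPn/negP => lB; have [b Bb] := level_neq0_nonempty lB.
by have := level_neq0_gt0 lB Bb; rewrite lt_min ltxx.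
Qed.

Lemma collapse1 h : realization K h -> collapse h 1 = apex_section (pushforward phi h).
Proof.
move=> Kh; congr normalize; apply/funext => v; rewrite /blend /excess /=; congr (_ + _).
by rewrite !max_l ?subr_le0 ?ler01 // (realization_le1 _ Kc Kh).
Qed.

Lemma cell_continuous_collapse : cell_continuous K K (fun h t => collapse h (1 - t)).
Proof.
split=> [h t Kh /andP[_ t1]|A h t KA [Kh hA] /andP[t0 t1]].
  by apply: collapse_realization => //; rewrite subr_ge0.
have s0 : 0 <= 1 - t by rewrite subr_ge0.
have cvg_fst : finsupp_cvg (cell_nbhs K A h t) fst h.
  by apply: finsupp_cvg_cell_fst => //; exact: face_finite KA.
apply: finsupp_cvg_normalize_blend => //.
- exact: pushforward_realization Kc phiS Kh.
- exact: augment_supp.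
- by move=> v; exact: le_pushforward.
- exact: gt0_or_excess.
- by apply: filterS (near_cell K A h t) => p [_ /andP[_]]; rewrite subr_ge0.
- exact: finsupp_cvg_pushforward.
- by apply: cvgB; [exact: cvg_cst|exact: cvg_cell_snd].
Qed.

Lemma apex_choice_homotopy_equivalence : cw_homotopy_equivalence K L (pushforward phi).
Proof.
have zero01 : 0 <= (0 : R) <= 1 by rewrite lexx ler01.
split.
  apply: (@cell_continuous_cw _ _ _ (fun x _ => pushforward phi x) Lc _ 0) => //.
  split=> [x t Kx _|A x t KA [_ xA] _]; first exact: pushforward_realization Kc phiS Kx.
  apply: finsupp_cvg_pushforward; apply: finsupp_cvg_cell_fst => //.
  exact: face_finite KA.
exists apex_section; split.
- exact: (cell_continuous_cw Kc cell_continuous_apex_section zero01).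
- apply: (cell_continuous_homotopic Kc cell_continuous_collapse) => x Kx.
    by rewrite subr0 collapse1.
  by rewrite subrr collapse0.
- apply: (cell_continuous_homotopic Lc cell_continuous_segment_to_id) => y Ly;
    apply/funext => v; rewrite /segment /=.
    by rewrite subr0 mul1r mul0r addr0.
  by rewrite subrr mul0r mul1r add0r.
Qed.

End ConeFibres.

Theorem cone_fibres_homotopy_equivalence {R : realType} (K L : complex R)
    (phi : R -> R) :
  is_complex K -> is_complex L -> simplicial K L phi ->
  (forall B, L B -> exists a, is_apex K phi B a) ->
  cw_homotopy_equivalence K L (realize_map phi).
Proof.
move=> Kc Lc phiS apexes.
have /choice[c c_apex] : forall B, exists a, L B -> is_apex K phi B a.
  by move=> B; have [/apexes[a]|] := pselect (L B); [exists a|exists 0].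
exact: (apex_choice_homotopy_equivalence Kc Lc phiS c_apex).
Qed.

Section Circle.
Context {R : realType}.
Implicit Types (x y s r p : R) (X Y A : set R).

Lemma mod1_on_circle x : on_circle (mod1 x).
Proof.
have := floor_itv x; rewrite intrD => /andP[fx xf].
by split; rewrite /mod1 ?subr_ge0 // ltrBlDl.
Qed.

Lemma mod1_id x : on_circle x -> mod1 x = x.
Proof.
by move=> [x0 x1]; rewrite /mod1 (@floor_def _ x 0) ?subr0 // add0r x0.
Qed.

Lemma mod1Dz x (m : int) : mod1 (x + m%:~R) = mod1 x.
Proof. by rewrite /mod1 floorDrz ?intr_int // intrKfloor intrD; lra. Qed.

Lemma mod1_mod1D x y : mod1 (mod1 x + y) = mod1 (x + y).
Proof. by rewrite {2}/mod1 addrAC -mulrNz mod1Dz. Qed.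

Lemma mod1_cases x : 0 <= x < 2 ->
  x < 1 /\ mod1 x = x \/ 1 <= x /\ mod1 x = x - 1.
Proof.
move=> /andP[x0 x2]; have [x1|x1] := ltP x 1; [left|right]; split=> //.
  exact: mod1_id.
by rewrite -[in LHS](subrK 1 x) (mod1Dz _ 1) mod1_id //; split; lra.
Qed.

Lemma circ_distC x y : circ_dist x y = circ_dist y x.
Proof. by rewrite /circ_dist distrC. Qed.

Lemma circ_dist_le x y s : circ_dist x y <= s <-> `|x - y| <= s \/ 1 - s <= `|x - y|.
Proof. by rewrite /circ_dist ge_min lerBlDr -lerBlDl; split=> /orP. Qed.

Lemma VR_is_complex Y s : is_complex (VR Y s).
Proof.
split=> [A []//|A B [Af _ AY As] BA B0]; split=> //.
- exact: sub_finite_set Af.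
- exact: subset_trans AY.
- by move=> x y /BA ? /BA ?; exact: As.
Qed.

Lemma Cech_is_complex X r : is_complex (Cech X r).
Proof.
split=> [A []//|A B [Af _ AX [p [p1 Ap]]] BA B0]; split=> //.
- exact: sub_finite_set Af.
- exact: subset_trans AX.
- by exists p; split=> // x /BA /Ap.
Qed.

Lemma VR_apex Y s (phi : R -> R) A a : Y a -> A (phi a) ->
  (forall y, Y y -> A (phi y) -> circ_dist y a <= s) -> is_apex (VR Y s) phi A a.
Proof.
move=> Ya Aa near_a; split=> // B KB BA.
have [Bf BY Bs] : [/\ finite_set B, B `<=` Y &
    forall x y, B x -> B y -> circ_dist x y <= s].
  by case: KB => [->|[? _ ? ?]]; split.
have near_aB y : (a |` B) y -> circ_dist y a <= s.
  by move=> [->|By]; apply: near_a => //; [exact: BY|apply: BA; exists y].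
split; [by rewrite finite_setU; split=> //; exact: finite_set1|by exists a; left| |].
  by move=> y [->|/BY].
move=> x y [->|Bx]; last by case=> [->|By]; [exact: near_aB (or_intror Bx)|exact: Bs].
by rewrite circ_distC; exact: near_aB.
Qed.

(* The closed arc of length [l] starting at [p], for [p] and its points in [0, 1). *)
Definition arc p l : set R := [set x | p <= x <= p + l \/ x + 1 <= p + l].

Section CechComplexOnCircle.
Variables (r : R) (X : set R).
Hypotheses (X_circle : X `<=` @on_circle R) (r_gt0 : 0 < r) (r_lt_half : r < 1 / 2).

Lemma circ_dist_le_arc p x : on_circle p -> on_circle x ->
  circ_dist x (mod1 (p + r)) <= r <-> arc p (2 * r) x.
Proof.
have [r0 r2] := (r_gt0, r_lt_half); move=> [p0 p1] [x0 x1].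
rewrite circ_dist_le /arc /= ler_norml ler_normr.
have [|[prC ->]|[prC ->]] := @mod1_cases (p + r).
    by apply/andP; split; lra.
  split=> [[/andP[? ?]|/orP[?|?]]|[/andP[? ?]|?]].
  - by left; apply/andP; split; lra.
  - by exfalso; lra.
  - by right; lra.
  - by left; apply/andP; split; lra.
  - by right; apply/orP; right; lra.
split=> [[/andP[? ?]|/orP[?|?]]|[/andP[? ?]|?]].
- by right; lra.
- by left; apply/andP; split; lra.
- by exfalso; lra.
- by right; apply/orP; left; lra.
- by left; apply/andP; split; lra.
Qed.

Lemma Cech_arc A : Cech X r A <-> [/\ finite_set A, A !=set0, A `<=` X &
  exists2 p, on_circle p & A `<=` arc p (2 * r)].
Proof.
split=> -[Af A0 AX].
  move=> [q [q1 Aq]]; split=> //; exists (mod1 (q - r)); first exact: mod1_on_circle.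
  move=> x Ax; apply/(circ_dist_le_arc (mod1_on_circle _) (X_circle (AX _ Ax))).
  by rewrite mod1_mod1D subrK mod1_id //; exact: Aq.
move=> [p p1 Ap]; split=> //; exists (mod1 (p + r)); split; first exact: mod1_on_circle.
by move=> x Ax; apply/circ_dist_le_arc; [|exact: X_circle (AX _ Ax)|exact: Ap].
Qed.

Let circumference_gt0 : 0 < 1 + 2 * r. Proof. by have := r_gt0; lra. Qed.

Let circumferenceK u : (1 + 2 * r) * (u / (1 + 2 * r)) = u.
Proof. by rewrite mulrC divfK // gt_eqF. Qed.

(* The points over [A] of the circle [0, 1 + 2r) obtained by stretching the one that
   carries [T_r r X]; there [pi_r] becomes reduction modulo 1. *)
Definition unrolled A : set R := [set u | 0 <= u < 1 + 2 * r /\ A (mod1 u)].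

Lemma mod1_unrolled A u : unrolled A u ->
  u < 1 /\ mod1 u = u \/ 1 <= u /\ mod1 u = u - 1.
Proof.
move=> [/andP[u0 uc] _]; apply: mod1_cases; apply/andP; split=> //.
by have := r_lt_half; lra.
Qed.

Lemma unrolled_sub1 A u : 1 <= u -> unrolled A u -> unrolled A (u - 1).
Proof.
move=> u1 [/andP[u0 uc] Au]; split; first by apply/andP; split; have := r_gt0; lra.
by rewrite (mod1Dz u (-1)).
Qed.

Lemma unrolled_add1 A u : u < 2 * r -> unrolled A u -> unrolled A (u + 1).
Proof.
move=> u2r [/andP[u0 uc] Au]; split; first by apply/andP; split; lra.
by rewrite (mod1Dz u 1).
Qed.

Lemma finite_unrolled A : finite_set A -> finite_set (unrolled A).
Proof.
move=> Af; apply: (@sub_finite_set _ _ (A `|` [set a + 1 | a in A])).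
  move=> u Au; have [_ Amod] := Au.
  case: (mod1_unrolled Au) => -[_ modE]; rewrite modE in Amod; first by left.
  by right; exists (u - 1); rewrite // subrK.
by rewrite finite_setU; split=> //; exact: finite_image.
Qed.

Let mod1_shrink u :
  0 <= u < 1 + 2 * r -> mod1 (u / (1 + 2 * r)) = u / (1 + 2 * r).
Proof.
move=> /andP[u0 uc]; apply: mod1_id; split; first by rewrite divr_ge0 // ltW.
by rewrite ltr_pdivrMr // mul1r.
Qed.

Lemma T_rE : T_r r X = [set y | unrolled X ((1 + 2 * r) * y)].
Proof.
rewrite /T_r /scale_shift; under eq_imagel do rewrite addr0 mulrC.
rewrite [X in _ `|` X](_ : _ =
  [set mod1 ((x + 1) / (1 + 2 * r)) | x in X `&` arc0 (2 * r)]); last first.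
  by apply: eq_imagel => x _; rewrite [_ * x]mulrC (mulrDl x 1) mul1r.
have := r_gt0 => ?; apply/seteqP; split=> y.
  case=> [[x Xx <-]|[x [Xx [_ x2r]] <-]]; have [x0 x1] := X_circle Xx.
    rewrite mod1_shrink; last by apply/andP; split; lra.
    by split; rewrite /= circumferenceK ?mod1_id //; apply/andP; split; lra.
  rewrite mod1_shrink; last by apply/andP; split; lra.
  split; rewrite /= circumferenceK; first by apply/andP; split; lra.
  by rewrite (mod1Dz x 1) mod1_id.
rewrite /=; set u := (1 + 2 * r) * y => /[dup] Xu [uc Xmod].
have yE : y = u / (1 + 2 * r) by rewrite /u mulrAC divff ?mul1r // gt_eqF.
case: (mod1_unrolled Xu) => -[u1 modE]; rewrite modE in Xmod.
  by left; exists u => //; rewrite yE mod1_shrink.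
right; exists (u - 1); last by rewrite subrK yE mod1_shrink.
by split=> //; split; move: uc => /andP[]; lra.
Qed.

Lemma T_r_unrolled A u : A `<=` X -> unrolled A u -> T_r r X (u / (1 + 2 * r)).
Proof. by rewrite T_rE => AX [uc /AX Xu]; split; rewrite /= circumferenceK. Qed.

Lemma pi_r_unrolled u : pi_r r (u / (1 + 2 * r)) = mod1 u.
Proof. by rewrite /pi_r circumferenceK. Qed.

Lemma unrolled_id A : A `<=` X -> A `<=` unrolled A.
Proof.
move=> AX x Ax; have [x0 x1] := X_circle (AX _ Ax); split; last by rewrite mod1_id.
by apply/andP; split; have := r_gt0; lra.
Qed.

Lemma pi_r_image : pi_r r @` T_r r X = X.
Proof.
apply/seteqP; split=> [_ [y + <-]|x Xx]; first by rewrite T_rE => -[].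
have XX := @subset_refl _ X; exists (x / (1 + 2 * r)).
  exact: T_r_unrolled XX (unrolled_id XX Xx).
by rewrite pi_r_unrolled mod1_id //; exact: X_circle.
Qed.

Definition adjacent (u v : R) := `|u - v| <= 2 * r \/ 1 <= `|u - v|.

Lemma circ_dist_adjacent y z : circ_dist y z <= 2 * r / (1 + 2 * r) <->
  adjacent ((1 + 2 * r) * y) ((1 + 2 * r) * z).
Proof.
have complement : 1 - 2 * r / (1 + 2 * r) = 1 / (1 + 2 * r).
  by rewrite -{1}[1](divff (lt0r_neq0 circumference_gt0)) -mulrBl addrK.
rewrite circ_dist_le complement /adjacent -mulrBr normrM (gtr0_norm circumference_gt0).
by rewrite ler_pdivlMr // ler_pdivrMr // [_ * (1 + _)]mulrC.
Qed.

Lemma arc_first_point A m u : unrolled A m -> unrolled A u -> m <= u ->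
  adjacent u m -> arc (mod1 m) (2 * r) (mod1 u).
Proof.
move=> Am Au mu; rewrite /adjacent ger0_norm ?subr_ge0 // /arc /=.
have [/andP[m0 mc] _] := Am; have [/andP[u0 uc] _] := Au; move: r_lt_half => r2.
case: (mod1_unrolled Am) => -[m1 ->]; case: (mod1_unrolled Au) => -[u1 ->] [um|um].
- by left; apply/andP; split; lra.
- by exfalso; lra.
- by right; lra.
- by left; apply/andP; split; lra.
- by exfalso; lra.
- by exfalso; lra.
- by left; apply/andP; split; lra.
- by exfalso; lra.
Qed.

Lemma pi_r_simplicial :
  simplicial (VR (T_r r X) (2 * r / (1 + 2 * r))) (Cech X r) (pi_r r).
Proof.
move=> A [Af A0 AT A_diam]; apply/Cech_arc; split; first exact: finite_image.
- by have [y Ay] := A0; exists (pi_r r y), y.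
- by rewrite -[X in _ `<=` X]pi_r_image; exact: image_subset.
have [m Am m_first] := finite_argmin (fun y => (1 + 2 * r) * y) Af A0.
exists (pi_r r m); first exact: mod1_on_circle.
move=> _ [y Ay <-]; move: AT; rewrite T_rE => AT.
apply: arc_first_point (AT _ Am) (AT _ Ay) (m_first y Ay) _.
by apply/circ_dist_adjacent; exact: A_diam.
Qed.

Section ApexOverArc.
Variables (A : set R) (p : R).
Hypotheses (Af : finite_set A) (A0 : A !=set0) (AX : A `<=` X).
Hypotheses (p_circle : on_circle p) (A_arc : A `<=` arc p (2 * r)).

Lemma unrolled_arc_cases u : unrolled A u ->
  [\/ p <= u <= p + 2 * r,
      u < p /\ unrolled A (u + 1) |
      p + 1 <= u /\ unrolled A (u - 1)].
Proof.
have [p0 p1] := p_circle; have := r_lt_half => r2.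
move=> Au; have [/andP[u0 uc] /A_arc] := Au; rewrite /arc /=.
case: (mod1_unrolled Au) => -[u1 ->] [/andP[? ?]|?].
- by apply: Or31; apply/andP.
- by apply: Or32; split; [lra|apply: unrolled_add1 => //; lra].
- by apply: Or33; split; [lra|exact: unrolled_sub1].
- by apply: Or31; apply/andP; split; lra.
Qed.

Let arc_points := unrolled A `&` [set u | p <= u <= p + 2 * r].

Let finite_arc_points : finite_set arc_points.
Proof. by apply: finite_setIl; exact: finite_unrolled. Qed.

Let arc_points_neq0 : arc_points !=set0.
Proof.
have [a Aa] := A0; have [a0 a1] := X_circle (AX Aa).
have unrolled_a := unrolled_id AX Aa; have [p0 p1] := p_circle; have := r_lt_half => ?.
case: (unrolled_arc_cases unrolled_a) => [pa|[ap Aa1]|[? _]].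
- by exists a.
- exists (a + 1); split=> //.
  by case: (A_arc Aa) => [/andP[? ?]|?]; apply/andP; split; lra.
- by exfalso; lra.
Qed.

Let arc_points_adjacent u v :
  p <= u <= p + 2 * r -> p <= v <= p + 2 * r -> adjacent u v.
Proof.
by move=> /andP[? ?] /andP[? ?]; left; rewrite ler_norml; apply/andP; split; lra.
Qed.

(* The apex is the last point of the arc, unless a point over [A] lies beyond the arc;
   in that case the arc starts before [2 r], and its first point is an apex. *)
Lemma unrolled_apex : exists2 a, unrolled A a & forall u, unrolled A u -> adjacent u a.
Proof.
have [p0 p1] := p_circle; move: r_gt0 r_lt_half => r0 r2.
have [[w [Aw pw]]|no_beyond] := pselect (exists w, unrolled A w /\ p + 2 * r < w).
  have [a [Aa pa] a_first] := finite_argmin id finite_arc_points arc_points_neq0.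
  have a_le u : p + 1 <= u -> unrolled A u -> unrolled A (u - 1) -> a <= u - 1 < 2 * r.
    move=> pu [/andP[u0 uc] _] Au1; apply/andP; split; last by lra.
    by apply: a_first; split=> //; apply/andP; split; lra.
  have a2r : a < 2 * r.
    case: (unrolled_arc_cases Aw) => [/andP[_ ?]|[? _]|[pw1 Aw1]]; [lra|lra|].
    by have /andP[/le_lt_trans aw /aw] := a_le w pw1 Aw Aw1.
  exists a => // u Au; case: (unrolled_arc_cases Au) => [pu|[up _]|[pu Au1]].
  - exact: arc_points_adjacent.
  - have [/andP[u0 _] _] := Au; move/andP: pa => [? _].
    by left; rewrite ler_norml; apply/andP; split; lra.
  - have /andP[? _] := a_le u pu Au Au1.
    by right; rewrite ler_normr; apply/orP; left; lra.
have [a [Aa pa] a_last] :=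
  finite_argmin (fun u => - u) finite_arc_points arc_points_neq0.
have in_arc u : unrolled A u -> u <= p + 2 * r.
  by move=> Au; rewrite leNgt; apply/negP => pu; apply: no_beyond; exists u.
exists a => // u Au; case: (unrolled_arc_cases Au) => [pu|[up Au1]|[pu _]].
- exact: arc_points_adjacent.
- have [/andP[u0 _] _] := Au; have u1_arc := in_arc _ Au1.
  have : - a <= - (u + 1) by apply: a_last; split=> //; apply/andP; split; lra.
  by right; rewrite ler_normr; apply/orP; right; lra.
- have u_arc := in_arc u Au.
  by apply: arc_points_adjacent => //; apply/andP; split; lra.
Qed.

End ApexOverArc.

Lemma pi_r_apex A : Cech X r A ->
  exists a, is_apex (VR (T_r r X) (2 * r / (1 + 2 * r))) (pi_r r) A a.
Proof.
move=> /Cech_arc[Af A0 AX [p p1 Ap]].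
have [u Au u_adjacent] := unrolled_apex Af A0 AX p1 Ap.
exists (u / (1 + 2 * r)); apply: VR_apex; first exact: T_r_unrolled Au.
  by rewrite pi_r_unrolled; case: Au.
rewrite T_rE => y [yc _] Ay; apply/circ_dist_adjacent; rewrite circumferenceK.
by apply: u_adjacent; split.
Qed.

End CechComplexOnCircle.
End Circle.

Theorem theorem9p3 (R : realType) (X : set R) (r : R) :
  X `<=` @on_circle R -> 0 < r -> r < 1 / 2 ->
  [/\ pi_r r @` T_r r X = X,
      simplicial (VR (T_r r X) (2 * r / (1 + 2 * r))) (Cech X r) (pi_r r) &
      cw_homotopy_equivalence (VR (T_r r X) (2 * r / (1 + 2 * r))) (Cech X r)
        (realize_map (pi_r r))].
Proof.
move=> X_circle r_gt0 r_lt_half.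
have simplicial_pi := pi_r_simplicial X_circle r_gt0 r_lt_half.
split=> //; first exact: pi_r_image.
apply: cone_fibres_homotopy_equivalence => //.
- exact: VR_is_complex.
- exact: Cech_is_complex.
- exact: pi_r_apex.
Qed.
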